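(* Suppose that $0<\alpha<1$ and that $f:[0,1]\to\mathbb{R}$ is an $\alpha$-Hölder and reverse $\alpha$-Hölder continuous function. Then $f$ is non-polar for the real-valued fractional Brownian motion $\{B^H(t), t\in[0,1]\}$ with Hurst index $H\in(0,1)$.
   Context: Real-valued fractional Brownian motion of Hurst index $H\in(0,1)$ is the centered Gaussian process with continuous paths and covariance $\mathbb{E}(B^H(s)B^H(t))=\frac12(|t|^{2H}+|s|^{2H}-|t-s|^{2H})$. A continuous function $f:[0,1]\to\mathbb{R}^d$ is reverse $\alpha$-Hölder continuous, $0<\alpha<1$, if there exists a constant $C>0$ such that for any interval $J\subset[0,1]$, $\sup_{s,t\in J}\|f(s)-f(t)\|\ge C|J|^\alpha$, where $|J|$ is the diameter of $J$ (here $d=1$). A Borel function $f$ is called polar for a process $X$ if for every $x\in\mathbb{R}$, $\mathbb{P}\{X_t+x=f(t)\text{ for some }t>0\}=0$; here, as $f$ and $X$ are considered on $[0,1]$, $t$ ranges over $(0,1]$. The function $f$ is non-polar for $X$ if it is not polar, i.e. if this probability is positive for some $x\in\mathbb{R}$. *)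

(* Defs.v *)
From mathcomp Require Import all_boot all_order all_algebra.
From mathcomp Require Import all_classical all_reals all_analysis.
Import Order.TTheory GRing.Theory Num.Theory.
Import numFieldNormedType.Exports.

Set Implicit Arguments.
Unset Strict Implicit.
Unset Printing Implicit Defensive.

Local Open Scope classical_set_scope.
Local Open Scope ring_scope.

(* Functions on [0, 1] and processes indexed by [0, 1] are represented by total
   functions on R; only their values on [0, 1] are constrained or used. *)

Section holder.
Context {R : realType}.
Implicit Types (alpha : R) (f : R -> R).

Definition holder01 alpha f :=
  exists C : R, forall s t : R, `[0, 1]%classic s -> `[0, 1]%classic t ->
    `|f s - f t| <= C * `|s - t| `^ alpha.

Definition diameter (A : set R) : R :=
  sup [set `|s - t| | s in A & t in A].

(* The supremum is taken over a bounded set because f is continuous on the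
   compact [0, 1]. For an empty J both sides are 0 when alpha != 0. *)
Definition reverse_holder01 alpha f :=
  {within `[0, 1]%classic, continuous f} /\
  exists2 C : R, 0 < C & forall J : interval R,
    [set` J] `<=` `[0, 1]%classic ->
    C * diameter [set` J] `^ alpha
      <= sup [set `|f s - f t| | s in [set` J] & t in [set` J]].

End holder.

Section processes.
Local Open Scope ereal_scope.
Context {R : realType} {d : measure_display} {T : measurableType d}
  (P : probability T R).

(* The second disjunct is the degenerate normal law of variance 0;
   [normal_prob m 0] is not the Dirac mass at m. *)
Definition gaussian_law (mu : set R -> \bar R) :=
  exists m : R,
    (exists2 s : R, (0 < s)%R &
       forall A : set R, measurable A -> mu A = normal_prob m s A) \/
    (forall A : set R, measurable A -> mu A = \d_m A).

Definition gaussian_process (I : set R) (X : R -> {RV P >-> R}) :=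
  forall (n : nat) (a t : 'I_n -> R), (forall i, I (t i)) ->
    gaussian_law (pushforward P (fun w => (\sum_(i < n) a i * X (t i) w)%R)).

Definition centered_process (I : set R) (X : R -> {RV P >-> R}) :=
  forall t, I t -> 'E_P[X t] = 0.

Definition continuous_paths (I : set R) (X : R -> {RV P >-> R}) :=
  forall w : T, {within I, continuous (fun t => X t w)}.

Definition fractional_brownian_motion (I : set R) (H : R)
    (B : R -> {RV P >-> R}) :=
  [/\ gaussian_process I B,
      centered_process I B,
      continuous_paths I B &
      forall s t, I s -> I t ->
        'E_P[fun w => (B s w * B t w)%R] =
        (2^-1 * (`|t| `^ (2 * H) + `|s| `^ (2 * H)
                 - `|t - s| `^ (2 * H)))%:E].

(* For a general Borel f the hitting event is a projection and need not be
   measurable, so probability zero is expressed by [negligible], i.e. being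
   included in a measurable set of probability 0. For a measurable event this is
   the same as P-probability 0. *)
Definition polar (I : set R) (f : R -> R) (X : R -> {RV P >-> R}) :=
  forall x : R,
    P.-negligible [set w | exists t : R, I t /\ (X t w + x)%R = f t].

Definition non_polar (I : set R) (f : R -> R) (X : R -> {RV P >-> R}) :=
  ~ polar I f X.

End processes.

(* Main.v *)
Require Import Defs.
From mathcomp Require Import all_boot all_order all_algebra.
From mathcomp Require Import all_classical all_reals all_analysis.
From mathcomp Require Import measurable_realfun ring lra.
Import Order.TTheory GRing.Theory Num.Theory.
Import numFieldNormedType.Exports.
Local Open Scope classical_set_scope.
Local Open Scope ring_scope.

(** In dimension one the levels x can be tested one rational at a time, because
    a continuous real path that is not constant takes a rational value. Suppose
    that f is polar. Countably many negligible events have a negligible union,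
    so almost surely the continuous path f - B takes no rational value on
    [1/2, 1]; by the intermediate value theorem it takes equal values at the
    two end points ([polar_increment_ae]). Hence the increment B 1 - B (1/2) is
    almost surely the deterministic number f 1 - f (1/2), and its variance is 0
    ([variance_ae_cst]). But the covariance of fractional Brownian motion gives
    this increment the variance (1/2)^(2H) > 0 ([fbm_increment_variance]), a
    contradiction. *)

(** Otherwise some rational lies strictly between the two end values and is
    attained in between. *)
Lemma continuous_avoids_rat_eq (R : realType) (g : R -> R) (a b : R) :
  a <= b -> {within `[a, b], continuous g} ->
  (forall (q : rat) (t : R), `[a, b]%classic t -> g t <> ratr q) ->
  g a = g b.
Proof.
move=> ab cg gNq; apply/eqP/negPn/negP => gab.
have : Num.min (g a) (g b) < Num.max (g a) (g b).
  by case: (ltgtP (g a) (g b)) gab.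
move=> /rat_in_itvoo[q]; rewrite inE /= => /andP[mq qM].
have [|t tab gtq] := IVT (v := ratr q) ab cg; last exact: (gNq q t tab gtq).
by rewrite (ltW mq) (ltW qM).
Qed.

Section random_variables.
Local Open Scope ereal_scope.
Context {R : realType} {d : measure_display} {T : measurableType d}
  (P : probability T R).

Lemma negligible_bigcup_countType (K : countType) (F : K -> set T) :
  (forall k, P.-negligible (F k)) -> P.-negligible (\bigcup_k F k).
Proof.
move=> nF.
pose G n := if unpickle n is Some k then F k else set0.
apply: (@negligibleS _ _ _ P (\bigcup_n G n)); last first.
  apply: negligible_bigcup => n; rewrite /G.
  by case: unpickle => [k|]; [exact: nF|exact: negligible_set0].
by move=> w [k _ Fkw]; exists (pickle k) => //; rewrite /G pickleK.
Qed.

(** Polarity excludes each rational value of f - X up to a negligible event;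
    only countably many values have to be excluded to make the path f - X take
    equal values at a and b. *)
Lemma polar_increment_ae (I : set R) (f : R -> R) (X : R -> {RV P >-> R})
    (a b : R) :
  (a <= b)%R -> `[a, b]%classic `<=` I ->
  {within `[a, b], continuous f} -> continuous_paths `[a, b]%classic X ->
  polar I f X ->
  {ae P, forall w, (X b w - X a w = f b - f a)%R}.
Proof.
move=> ab abI cf cX polarX.
have := @negligible_bigcup_countType _ _ (fun q : rat => polarX (ratr q)).
apply: negligibleS => w /= NXf; apply: contrapT => nw; apply: NXf.
suff : (f a - X a w = f b - X b w)%R by lra.
apply: (@continuous_avoids_rat_eq _ (fun t => f t - X t w)%R) => //.
  by move=> t; apply: continuousB; [exact: cf|exact: cX].
move=> q t /abI It ftq; apply: nw; exists q => //; exists t; split => //.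
by rewrite -ftq addrC subrK.
Qed.

Lemma Lfun2_sqr_integral (X : {RV P >-> R}) :
  'E_P[fun w => (X w * X w)%R] < +oo -> (X : T -> R) \in Lfun P 2%:E.
Proof.
move=> X2; apply/andP; split; rewrite inE /=; first exact: measurable_funPT.
rewrite /finite_norm unlock poweR_lty//; move: X2; rewrite unlock.
congr (_ < _); apply: eq_integral => w _ /=.
by rewrite powR_mulrn// real_normK ?num_real// expr2.
Qed.

Lemma variance_ae_cst (X : T -> R) (c : R) : measurable_fun [set: T] X ->
  {ae P, forall w, X w = c} -> 'V_P[X] = 0.
Proof.
move=> mX Xc.
have EX : 'E_P[X] = c%:E.
  rewrite -(expectation_cst P) unlock; apply: ae_eq_integral => //.
  - exact/measurable_EFinP.
  - by apply/measurable_EFinP; exact: measurable_cst.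
  - by apply: filterS Xc => w /= ->.
rewrite /variance covariance.unlock EX /=.
apply: etrans (expectation_cst P 0%R); rewrite unlock.
apply: ae_eq_integral => //.
- apply/measurable_EFinP.
  by apply: measurable_funM; apply: measurable_funB => //; exact: measurable_cst.
- by apply/measurable_EFinP; exact: measurable_cst.
- by apply: filterS Xc => w /= Xw _; rewrite /GRing.mul /= Xw subrr mulr0.
Qed.

Lemma fbm_increment_variance (I : set R) (H : R) (B : R -> {RV P >-> R})
    (s t : R) :
  (0 < H)%R -> fractional_brownian_motion I H B -> I s -> I t ->
  'V_P[B t \- B s]%R = (`|t - s| `^ (2 * H))%:E.
Proof.
move=> H0 [_ cB _ covB] Is It.
(* The covariance on the diagonal is a finite second moment. *)
have L2 u : I u -> (B u : T -> R) \in Lfun P 2%:E.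
  by move=> Iu; apply: Lfun2_sqr_integral; rewrite covB// ltry.
have cov u v : I u -> I v -> covariance P (B u) (B v) =
    (2^-1 * (`|v| `^ (2 * H) + `|u| `^ (2 * H) - `|v - u| `^ (2 * H)))%:E.
  move=> Iu Iv; rewrite covarianceE ?Lfun2_mul_Lfun1 ?L2//.
  - by rewrite !cB// mule0 sube0 -covB.
  - by rewrite Lfun_subset12 ?fin_num_measure ?L2.
  - by rewrite Lfun_subset12 ?fin_num_measure ?L2.
rewrite varianceB ?L2// /variance !cov// !subrr normr0 powR0; last first.
  by rewrite mulf_neq0 ?gt_eqF.
rewrite -[LHS]/(EFin _) distrC; congr EFin.
by field.
Qed.

End random_variables.

Theorem proposition3p7 (R : realType) (d : measure_display)
    (T : measurableType d) (P : probability T R)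
    (H : R) (B : R -> {RV P >-> R}) (alpha : R) (f : R -> R) :
  0 < H < 1 ->
  fractional_brownian_motion `[0, 1]%classic H B ->
  0 < alpha < 1 ->
  holder01 alpha f ->
  reverse_holder01 alpha f ->
  non_polar `]0, 1]%classic f B.
Proof.
move=> /andP[H0 _] fbmB _ _ [cf _] polarB.
(* The interval has to stay away from 0, where hitting does not count; the
   left end 1/2 is an arbitrary choice. *)
have half01 : `[2^-1 : R, 1]%classic `<=` `]0, 1]%classic.
  by move=> t /=; rewrite !in_itv /= => /andP[/(lt_le_trans _)->].
have half01' : `[2^-1 : R, 1]%classic `<=` `[0, 1]%classic.
  by move=> t /half01 /=; rewrite !in_itv /= => /andP[/ltW -> ->].
have le_half1 : 2^-1 <= 1 :> R by rewrite invf_le1// ler1n.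
have [_ _ cB _] := fbmB.
have cstB : {ae P, forall w, B 1 w - B 2^-1 w = f 1 - f 2^-1}.
  apply: polar_increment_ae polarB => //.
    exact: continuous_subspaceW cf.
  by move=> w; apply: continuous_subspaceW (cB w).
have V0 : 'V_P[B 1 \- B 2^-1] = 0%E.
  apply: variance_ae_cst cstB.
  by apply: measurable_funB; exact: measurable_funPT.
have := @fbm_increment_variance _ _ _ _ _ _ _ 2^-1 1 H0 fbmB.
rewrite V0 /= !in_itv /= lexx ler01 invr_ge0 ler0n le_half1 => /(_ isT isT)[].
by apply/eqP; rewrite lt_eqF// powR_gt0// normr_gt0 subr_eq0; lra.
Qed.
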